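(* Let $m\ge 5$ and $0<p\le 1/2$. Let $D(p)$ be the rank difference function associated with the family of finite tilings $(G_t(m))_{t\ge m}$. Then $$D(p)=\frac{2}{m}\sum_{C\in\mathcal{C}(v)}\frac{1}{|V(C)|}\left(p^{|E(C)|}(1-p)^{|\partial(C)|}-(1-p)^{|E(C)|}p^{|\partial(C)|}\right),$$ where $\mathcal{C}(v)$ denotes the set of finite connected subgraphs $C$ of $G(m)$ containing a fixed vertex $v$.
   Context: **Infinite graph.** For $m\ge 5$, $G(m)$ is the infinite planar graph that is $m$-regular and tiles the (hyperbolic) plane by faces of length $m$. For a subgraph $C$ of $G(m)$ (any set of vertices $V(C)$ together with any set of edges $E(C)$ with endpoints in $V(C)$, not necessarily induced; the single vertex $v$ with no edges is allowed), $\partial(C)$ is the set of edges of $G(m)$ that have at least one endpoint in $V(C)$ and do not belong to $E(C)$. **Tilings.** A tiling $G=(V,E,F)$ of a surface is a graph $(V,E)$ cellularly embedded in a smooth surface, $F$ being its set of faces; a face is identified with the set of edges on its boundary. Its dual tiling $G^*=(V^*,E^*,F^* )$ has $V^*=F$; each edge of $E$ lies in exactly two faces and gives an edge of $E^*$ joining these two faces, so $E$ and $E^*$ are identified; the faces of $G^*$ correspond to the vertices of $G$. The graph and its dual have no loops or multiple edges. **Finite tilings.** $(G_t(m))_{t\ge m}$, $G_t(m)=(V_t,E_t,F_t)$, also written $G_t$, is a fixed family of finite connected tilings of surfaces (Širáň's family) obtained as coset tilings of finite quotients $\bar T$ (reductions modulo suitable primes of a matrix representation) of $T(m)=\langle a,b\mid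 a^m=b^m=(ab)^2=1\rangle$: vertices, edges and faces are the left cosets of $\langle a\rangle$, $\langle ab\rangle$, $\langle b\rangle$ in $\bar T$, incidence being non-empty intersection. These tilings are $m$-regular with all faces of length $m$; vertex-, edge- and face-transitive; self-dual; every ball of radius $t$ of $G_t(m)$ is isomorphic (as a piece of a tiling, i.e. respecting vertices, edges and faces) to every ball of radius $t$ in $G(m)$; and there is a constant $K$ such that $|V_t|\le K^t$ for all $t$. **Rank difference function.** For $\varepsilon\subset E_t$, let $\bar\varepsilon=E_t\setminus\varepsilon$; $G_{t,\varepsilon}$ is the subgraph of $G_t$ with vertex set $V_t$ and edge set $\varepsilon$, and $G^*_{t,\bar\varepsilon}$ is the subgraph of $G_t^*$ with vertex set $V_t^*$ and edge set $\bar\varepsilon$ (regarded as a subset of $E_t^*$). The rank of a graph is the rank over $\mathbb{F}_2$ of its vertex-edge incidence matrix. Let $\mathbb{E}_p$ be expectation when $\varepsilon$ contains each edge of $E_t$ independently with probability $p$. Then $$D(p)=\limsup_{t\to\infty}\mathbb{E}_p\left(\frac{\operatorname{rank}G^*_{t,\bar\varepsilon}-\operatorname{rank}G_{t,\varepsilon}}{|E_t|}\right).$$ *)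

(* Defs.v *)
From HB Require Import structures.
From mathcomp Require Import all_boot all_order all_algebra all_fingroup.
From mathcomp Require Import finmap.
From mathcomp Require Import all_classical all_reals all_analysis.
Set Implicit Arguments.
Unset Strict Implicit.
Unset Printing Implicit Defensive.
Import Order.TTheory GRing.Theory Num.Theory.
Import numFieldNormedType.Exports.
Local Open Scope classical_set_scope.
Local Open Scope card_scope.
Local Open Scope ring_scope.

(* [on v e]: v is an endpoint of e; [bd e f]: e lies on the boundary of f.
   A face is only known through the edges on its boundary, so vertex-face
   incidence is not recorded. *)
Record tiling := Tiling {
  vertex : choiceType;
  edge : choiceType;
  face : choiceType;
  on : vertex -> edge -> bool;
  bd : edge -> face -> bool }.

Record finTiling := FinTiling {
  fvertex : finType;
  fedge : finType;
  fface : finType;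
  fon : fvertex -> fedge -> bool;
  fbd : fedge -> fface -> bool }.

Coercion tiling_of_finTiling (T : finTiling) : tiling :=
  Tiling (@fon T) (@fbd T).

Definition dual (T : tiling) : tiling :=
  Tiling (fun f e => @bd T e f) (fun e v => @on T v e).

(* No loops (every edge has exactly two ends) and no multiple edges. *)
Definition simple_graph (T : tiling) : Prop :=
  (forall e, [set v | @on T v e] #= `I_2) /\
  (forall e e', (forall v, @on T v e = @on T v e') -> e = e').

(* [simple_graph (dual T)] contains the fact that every edge lies in exactly
   two faces. *)
Definition regular_tiling (m : nat) (T : tiling) : Prop :=
  [/\ simple_graph T, simple_graph (dual T),
      forall v, [set e | @on T v e] #= `I_m &
      forall f, [set e | @bd T e f] #= `I_m].

Section Balls.
Variable T : tiling.

Definition adjacent (u w : vertex T) : Prop :=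
  u != w /\ exists e, on u e /\ on w e.

Fixpoint ball_vertex (n : nat) (v : vertex T) : set (vertex T) :=
  if n is n'.+1 then
    ball_vertex n' v `|`
    [set w | exists2 u, ball_vertex n' v u & adjacent u w]
  else [set v].

Definition ball_edge (n : nat) (v : vertex T) : set (edge T) :=
  [set e | forall u, on u e -> ball_vertex n v u].

Definition ball_face (n : nat) (v : vertex T) : set (face T) :=
  [set f | forall e, bd e f -> ball_edge n v e].

Definition connected_graph : Prop :=
  forall u w : vertex T, exists n, ball_vertex n u w.

End Balls.

(* (phi, psi, chi) is an isomorphism from the piece (A1, B1, C1) of T1 onto the
   piece (A2, B2, C2) of T2. *)
Definition piece_iso (T1 T2 : tiling)
    (A1 : set (vertex T1)) (B1 : set (edge T1)) (C1 : set (face T1))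
    (A2 : set (vertex T2)) (B2 : set (edge T2)) (C2 : set (face T2))
    (phi : vertex T1 -> vertex T2) (psi : edge T1 -> edge T2)
    (chi : face T1 -> face T2) : Prop :=
  [/\ set_bij A1 A2 phi, set_bij B1 B2 psi, set_bij C1 C2 chi,
      forall v e, A1 v -> B1 e -> on (phi v) (psi e) = on v e &
      forall e f, B1 e -> C1 f -> bd (psi e) (chi f) = bd e f].

Definition tiling_iso (T1 T2 : tiling)
    (phi : vertex T1 -> vertex T2) (psi : edge T1 -> edge T2)
    (chi : face T1 -> face T2) : Prop :=
  piece_iso setT setT setT setT setT setT phi psi chi.

Definition self_dual (T : tiling) : Prop :=
  exists phi psi chi, @tiling_iso T (dual T) phi psi chi.

Definition transitive_tiling (T : tiling) : Prop :=
  [/\ forall u v : vertex T,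
        exists phi psi chi, @tiling_iso T T phi psi chi /\ phi u = v,
      forall d e : edge T,
        exists phi psi chi, @tiling_iso T T phi psi chi /\ psi d = e &
      forall f g : face T,
        exists phi psi chi, @tiling_iso T T phi psi chi /\ chi f = g].

(* Isomorphism of balls of radius n, sending centre to centre. *)
Definition isomorphic_balls (n : nat) (T1 T2 : tiling)
    (v1 : vertex T1) (v2 : vertex T2) : Prop :=
  exists phi psi chi,
    piece_iso (ball_vertex n v1) (ball_edge n v1) (ball_face n v1)
              (ball_vertex n v2) (ball_edge n v2) (ball_face n v2)
              phi psi chi /\
    phi v1 = v2.

(* T is carried by a locally finite cell decomposition of the plane R^2: the
   open cells (points, open arcs, open discs) partition the plane; closed cells
   are embedded and their boundaries are prescribed by the incidences.  Only the
   topology of the plane matters, so this also covers the hyperbolic plane. *)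
Section PlaneTiling.
Variables (R : realType) (T : tiling).
Variables (pt : vertex T -> R * R) (arc : edge T -> R -> R * R)
  (disc : face T -> R * R -> R * R).

Definition closed_disc : set (R * R) := [set z | z.1 ^+ 2 + z.2 ^+ 2 <= 1].

Definition open_cell (c : vertex T + edge T + face T) : set (R * R) :=
  match c with
  | inl (inl v) => [set pt v]
  | inl (inr e) => arc e @` [set s | 0 < s < 1]
  | inr f => disc f @` [set z | z.1 ^+ 2 + z.2 ^+ 2 < 1]
  end.

Record plane_cells : Prop := {
  arc_continuous : forall e, {within `[0, 1], continuous (arc e)};
  arc_injective : forall e, set_inj `[0, 1] (arc e);
  arc_ends : forall e, pt @` [set v | on v e] = [set arc e 0; arc e 1];
  disc_continuous : forall f, {within closed_disc, continuous (disc f)};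
  disc_injective : forall f, set_inj closed_disc (disc f);
  disc_boundary : forall f,
    disc f @` [set z | z.1 ^+ 2 + z.2 ^+ 2 = 1] =
    \bigcup_(e in [set e | bd e f]) (arc e @` `[0, 1]);
  cells_partition : forall x : R * R, exists! c, open_cell c x;
  cells_locally_finite : forall x : R * R, exists2 U, nbhs x U &
    finite_set [set c | open_cell c `&` U !=set0] }.

End PlaneTiling.

Definition tiles_plane (R : realType) (T : tiling) : Prop :=
  exists pt arc disc, @plane_cells R T pt arc disc.

(* This determines T = G(m) up to isomorphism. *)
Definition regular_plane_tiling (R : realType) (m : nat) (T : tiling) : Prop :=
  [/\ connected_graph T, infinite_set [set: vertex T], regular_tiling m T &
      tiles_plane R T].

(* Vertices, edges and faces: left cosets of <a>, <ab> and <b>. *)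
Section CosetTiling.
Variables (gT : finGroupType) (a b : gT).

Definition lcosets_of (x : gT) : finType :=
  {A : {set gT} | A \in lcosets <[x]>%g [set: gT]%SET}.

Definition meets (x y : gT) (A : lcosets_of x) (B : lcosets_of y) : bool :=
  (val A :&: val B)%SET != finset.set0.

Definition coset_tiling : finTiling :=
  FinTiling (@meets a (a * b)%g) (@meets (a * b)%g b).

End CosetTiling.

(* gT is a quotient of < a, b | a^m = b^m = (ab)^2 = 1 >: this is what
   [[set: gT] \homg Grp (a : b : a ^+ m, b ^+ m, (a * b) ^+ 2)] unfolds to,
   with the images a, b of the generators made explicit. *)
Definition triangle_quotient (m : nat) (gT : finGroupType) (a b : gT) : Prop :=
  [/\ (<[a]> <*> <[b]> = [set: gT]%SET)%g,
      (a ^+ m = 1)%g, (b ^+ m = 1)%g & ((a * b) ^+ 2 = 1)%g].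

(* The properties of the family of quotients (gT t)_{t >= m} and of the coset
   tilings G_t(m); G is the infinite tiling G(m).  The terms t < m are
   irrelevant. *)
Record tiling_family (m : nat) (G : tiling) (gT : nat -> finGroupType)
    (a b : forall t, gT t) : Prop := {
  family_quotient : forall t, (m <= t)%N -> triangle_quotient m (a t) (b t);
  family_connected : forall t, (m <= t)%N ->
    connected_graph (coset_tiling (a t) (b t));
  family_regular : forall t, (m <= t)%N ->
    regular_tiling m (coset_tiling (a t) (b t));
  family_transitive : forall t, (m <= t)%N ->
    transitive_tiling (coset_tiling (a t) (b t));
  family_self_dual : forall t, (m <= t)%N ->
    self_dual (coset_tiling (a t) (b t));
  family_balls : forall t, (m <= t)%N ->
    forall (u : vertex (coset_tiling (a t) (b t))) (v : vertex G),
      isomorphic_balls t u v;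
  family_growth : exists K : nat, forall t, (m <= t)%N ->
    (#|fvertex (coset_tiling (a t) (b t))| <= K ^ t)%N }.

(* Rank over F_2 of the incidence matrix of the graph (V, eps). *)
Definition graph_rank (V E : finType) (inc : V -> E -> bool) (eps : {set E}) :
    nat :=
  \rank (\matrix_(i < #|V|, j < #|eps|)
           (inc (enum_val i) (enum_val j))%:R : 'M['F_2]_(#|V|, #|eps|)).

Definition primal_rank (T : finTiling) (eps : {set fedge T}) : nat :=
  graph_rank (@fon T) eps.

Definition dual_rank (T : finTiling) (eps : {set fedge T}) : nat :=
  graph_rank (fun f e => @fbd T e f) eps.

(* Expectation when the random set contains each element independently with
   probability p. *)
Definition bernoulli_expectation (R : realType) (E : finType) (p : R)
    (X : {set E} -> R) : R :=
  \sum_(eps : {set E}) p ^+ #|eps| * (1 - p) ^+ #|(~: eps)%SET| * X eps.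

Definition rank_difference (R : realType) (T : nat -> finTiling) (p : R) :
    \bar R :=
  limn_esup (fun t => (bernoulli_expectation p (fun eps : {set fedge (T t)} =>
    ((dual_rank (~: eps)%SET)%:R - (primal_rank eps)%:R) / #|fedge (T t)|%:R))%:E).

Section Subgraphs.
Variable G : tiling.

(* A pair (V(C), E(C)) of finite sets. *)
Definition subgraph : choiceType := ({fset vertex G} * {fset edge G})%type.

Definition linked (C : subgraph) : rel (vertex G) :=
  fun u w => has (fun e => on u e && on w e) C.2.

(* Finite connected subgraphs containing v. *)
Definition clusters (v : vertex G) : set subgraph :=
  [set C | [/\ v \in C.1,
               forall e u, e \in C.2 -> on u e -> u \in C.1 &
               forall u w, u \in C.1 -> w \in C.1 ->
                 exists2 s, path (linked C) u s & last u s = w]].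

Definition boundary (C : subgraph) : set (edge G) :=
  [set e | (exists2 u, u \in C.1 & on u e) /\ e \notin C.2].

(* The boundary is finite when every vertex has finite degree; the junk value
   of [fset_set] on infinite sets is not met in G(m). *)
Definition card_boundary (C : subgraph) : nat := #|` fset_set (boundary C)|%N.

End Subgraphs.

(* Sum over D of an absolutely summable family of real numbers. *)
Definition signed_esum (R : realType) (I : choiceType) (D : set I)
    (f : I -> R) : \bar R :=
  (\esum_(i in D) (EFin \o f)^\+ i - \esum_(i in D) (EFin \o f)^\- i)%E.

(* Main.v *)
Require Import Defs.
From HB Require Import structures.
From mathcomp Require Import all_boot all_order all_algebra all_fingroup.
From mathcomp Require Import finmap.
From mathcomp Require Import all_classical all_reals all_analysis.
Set Implicit Arguments.
Unset Strict Implicit.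
Unset Printing Implicit Defensive.
Import Order.TTheory GRing.Theory Num.Theory.
Import numFieldNormedType.Exports.
Local Open Scope ring_scope.

(** Over F_2 the rank of a graph is its number of vertices minus its number of
    connected components [graph_rankE], and the number of components is the sum
    over all vertices u of 1 / |component of u|.  So the expected rank of the
    open subgraph at density q is |V| minus the sum over u of
    E_q (1 / |component of u|).

    The dual rank needs no separate analysis.  An edge is closed with
    probability 1 - p, so by self-duality the expected rank of the dual graph
    on the closed edges is the expected primal rank at density 1 - p
    [expectation_dual_rank].  The factors |V| cancel, and m |V| = 2 |E| turns
    the quantity under the limsup into
      (2 / m) (mean_share p - mean_share (1 - p)),
    where mean_share q is the average over u of E_q (1 / |component of u|)
    [mean_rank_difference].

    It remains to see that mean_share q converges to the sum over the finite
    clusters C of G(m) at v of q^|E(C)| (1-q)^|boundary(C)| / |V(C)|.  In a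
    finite tiling, this sum over the clusters at u is exactly
    E_q (1 / |component of u|) [expectation_component], because the component
    of u is C when the edges of C are open and those of its boundary closed.
    A cluster with at most t vertices lies, with its boundary, in the ball of
    radius t about u, so the isomorphism of balls matches these clusters of
    G_t(m) with those of G(m) [image_small_clusters].  The larger ones
    contribute at most 1 / (t + 1), since 1 / |V(C)| is at most that and
    probabilities add up to at most 1 [mean_share_bounds].  Hence mean_share is
    squeezed to the full sum [mean_share_cvg]: the limsup is a limit, and no
    knowledge of infinite clusters is involved.  The same comparison bounds the
    sum by 1 at both densities, which gives summability. *)

(** * Independent open edges *)

(** Expanding the product of (F e + G e) over all edges e, with F e the weight of
    e being open and G e that of e being closed, gives one term per
    configuration; setting F to 0 on B and G to 0 on A keeps exactly the
    configurations of the event, and the product is q on A, 1 - q on B and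
    q + (1 - q) = 1 elsewhere. *)
Lemma bernoulli_cylinder (R : realType) (E : finType) (q : R)
    (A B : {set E}) : [disjoint A & B] ->
  \sum_(eps : {set E} | (A \subset eps) && [disjoint B & eps])
     q ^+ #|eps| * (1 - q) ^+ #|(~: eps)%SET| = q ^+ #|A| * (1 - q) ^+ #|B|.
Proof.
move=> dAB.
pose F e : R := if e \in B then 0 else q.
pose G e : R := if e \in A then 0 else 1 - q.
have -> : q ^+ #|A| * (1 - q) ^+ #|B| = \prod_e (F e + G e).
  rewrite -!prodr_const big_mkcond [X in _ * X]big_mkcond -big_split /=.
  apply: eq_bigr => e _; rewrite /F /G.
  case: ifPn => [eA|_]; first by rewrite (disjointFr dAB eA) mulr1 addr0.
  by case: ifP => _; rewrite mul1r ?add0r // addrC subrK.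
rewrite bigA_distr big_mkcond /=; apply: eq_bigr => J _.
case: ifPn => [/andP[AJ BJ]|].
  rewrite -!prodr_const big_mkcond [X in _ * X]big_mkcond -big_split /=.
  apply: eq_bigr => e _; rewrite inE /F /G; case: ifPn => /= eJ.
    by rewrite (disjointFl BJ eJ) mulr1.
  by rewrite mul1r ifN //; apply: contra eJ; apply: (fintype.subsetP AJ).
rewrite negb_and => /orP[/subsetPn[e eA eJ]|/pred0Pn[e /= /andP[eB eJ]]].
  by rewrite (bigD1 e) //= (negbTE eJ) /G eA mul0r.
by rewrite (bigD1 e) //= eJ /F eB mul0r.
Qed.

Lemma bernoulli_total (R : realType) (E : finType) (q : R) :
  \sum_(eps : {set E}) q ^+ #|eps| * (1 - q) ^+ #|(~: eps)%SET| = 1.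
Proof.
have d0 : [disjoint (finset.set0 : {set E}) & (finset.set0 : {set E})].
  by rewrite finset.disjoints_subset finset.sub0set.
have := bernoulli_cylinder q d0; rewrite finset.cards0 !expr0 mulr1 => E0.
rewrite -[RHS]E0.
apply: eq_bigl => eps.
rewrite finset.sub0set /=; apply/esym/pred0P => e /=.
by rewrite finset.in_set0.
Qed.

(** * Rank and connected components *)

Section GraphRank.
Variables (V E : finType) (inc : V -> E -> bool).

Definition open_adj (eps : {set E}) : rel V :=
  fun x y => [exists e in eps, inc x e && inc y e].

Definition component (eps : {set E}) (u : V) : {set V} :=
  [set w | connect (open_adj eps) u w]%SET.

Lemma open_adj_sym eps : connect_sym (open_adj eps).
Proof.
apply: sym_connect_sym => x y; apply: eq_existsb => e.
by rewrite [inc y e && _]andbC.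
Qed.

Lemma component_gt0 eps u : (0 < #|component eps u|)%N.
Proof. by apply/card_gt0P; exists u; rewrite inE connect0. Qed.

(** Each component contributes |component| terms 1 / |component|; components are
    counted by their roots. *)
Lemma sum_inv_component (R : realType) (eps : {set E}) :
  \sum_u (#|component eps u|%:R)^-1 = #|roots (open_adj eps)|%:R :> R.
Proof.
have cs := open_adj_sym eps.
rewrite (partition_big (fingraph.root (open_adj eps)) (mem (roots (open_adj eps)))) /=;
  last by move=> u _; rewrite inE roots_root.
rewrite -sum1_card natr_sum; apply: eq_bigr => r rr.
have -> : \sum_(u | fingraph.root (open_adj eps) u == r) (#|component eps u|%:R)^-1
    = \sum_(u in component eps r) (#|component eps r|%:R)^-1 :> R.
  apply: eq_big => [u|u /eqP ur].
    by rewrite inE -(root_connect cs) eq_sym; move/eqP: rr => ->.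
  congr (_%:R^-1); apply: eq_card => w; rewrite !inE.
  by apply: (same_connect cs); rewrite -(root_connect cs) ur eq_sym; exact: rr.
rewrite sumr_const -[LHS]mulr_natr mulVf // pnatr_eq0 -lt0n.
exact: component_gt0.
Qed.

Hypothesis two_ends : forall e, exists x y,
  x != y /\ forall w, inc w e = (w == x) || (w == y).

(** A row vector is killed by the incidence matrix M exactly when it takes the same
    value at both ends of every open edge (this uses characteristic 2), that is,
    when it is constant on components.  The indicators K of the components are
    therefore a basis of the kernel, and the statement is rank-nullity. *)
Lemma card_roots_rank (eps : {set E}) :
  (graph_rank inc eps + #|roots (open_adj eps)| = #|V|)%N.
Proof.
rewrite /graph_rank.
set M := (X in \rank X).
have cs := open_adj_sym eps.
pose rt := fingraph.root (open_adj eps).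
pose r := [set x | roots (open_adj eps) x]%SET.
have -> : #|roots (open_adj eps)| = #|r| by rewrite cardsE.
pose K : 'M['F_2]_(#|r|, #|V|) :=
  \matrix_(k, i) (rt (enum_val i) == enum_val k)%:R.
have Kfree : row_free K.
  (* K is the identity on the columns of the roots. *)
  apply/row_freeP; exists (\matrix_(i, k) (enum_val i == enum_val k)%:R).
  apply/matrixP => k l; rewrite !mxE.
  rewrite (bigD1 (enum_rank (enum_val l))) //= !mxE enum_rankK eqxx mulr1.
  rewrite big1 ?addr0 => [|i ni]; last first.
    rewrite !mxE; case: (eqVneq (enum_val i) (enum_val l)) => [il|_].
      by rewrite -il enum_valK eqxx in ni.
    by rewrite mulr0.
  have /eqP -> : rt (enum_val l) == enum_val l by have := enum_valP l; rewrite inE.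
  by rewrite (inj_eq enum_val_inj) eq_sym.
have xedge (x : 'rV['F_2]_#|V|) e (je : e \in eps) :
    (x *m M) ord0 (enum_rank_in je e) =
    \sum_(w | inc w e) x ord0 (enum_rank w).
  rewrite mxE (reindex_onto enum_rank enum_val) /=; last by move=> i _; rewrite enum_valK.
  rewrite [RHS]big_mkcond; apply: eq_big => [w|w _]; first by rewrite enum_rankK eqxx.
  rewrite mxE enum_rankK enum_rankK_in //; by case: ifP; rewrite ?mulr1 ?mulr0.
have char2 (y : 'F_2) : y + y = 0.
  by rewrite -mulr2n -mulr_natr (_ : 2%:R = 0) ?mulr0 //; apply: val_inj.
have KM : K *m M = 0.
  apply/row_matrixP => k; rewrite row_mul row0; apply/rowP => j; rewrite [RHS]mxE.
  have := xedge (row k K) _ (enum_valP j); rewrite enum_valK_in => ->.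
  have [x [y [xy He]]] := two_ends (enum_val j).
  rewrite (bigD1 x) /=; last by rewrite He eqxx.
  rewrite (bigD1 y) /=; last by rewrite He eqxx orbT eq_sym.
  rewrite big1 ?addr0; last first.
    by move=> w; rewrite He => /andP[/andP[/orP[->|->]]]; rewrite ?andbF.
  rewrite !mxE !enum_rankK (_ : rt x = rt y) ?char2 //.
  apply/eqP; rewrite (root_connect cs); apply: connect1; apply/existsP.
  by exists (enum_val j); rewrite enum_valP !He !eqxx orbT.
have kerK : (kermx M :=: K)%MS.
  apply/eqmxP; apply/andP; split; last by apply/sub_kermxP.
  apply/rV_subP => x /sub_kermxP xM.
  have xadj u w : open_adj eps u w -> x ord0 (enum_rank u) = x ord0 (enum_rank w).
    move=> /existsP[e /and3P[ee ue we]].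
    have [->//|uw] := eqVneq u w.
    have := xedge x _ ee; rewrite xM mxE.
    have [a [b [ab He]]] := two_ends e.
    rewrite (bigD1 u) // (bigD1 w) /=; last by rewrite we eq_sym.
    rewrite big1 ?addr0; last first.
      move=> z; move: ue we; rewrite !He => ue we /andP[/andP[ze zu] zw].
      move: ze ue we zu zw uw.
      by do 3!case/orP=> /eqP->; rewrite ?eqxx.
    move=> /esym/eqP; rewrite addr_eq0 => /eqP ->.
    by apply/eqP; rewrite -subr_eq0 -opprD char2 oppr0.
  have xconn u w : connect (open_adj eps) u w -> x ord0 (enum_rank u) = x ord0 (enum_rank w).
    move=> /connectP[s]; elim: s u => [|z s IH] u /=; first by move=> _ ->.
    by move=> /andP[/xadj -> ps] wl; apply: IH.
  apply/submxP; exists (\row_k x ord0 (enum_rank (enum_val k))).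
  apply/rowP => i; rewrite !mxE.
  have rr : rt (enum_val i) \in r by rewrite inE roots_root.
  rewrite (bigD1 (enum_rank_in rr (rt (enum_val i)))) //= !mxE enum_rankK_in //.
  rewrite eqxx mulr1 big1 ?addr0 => [|k nk]; last first.
    rewrite !mxE; case: eqP => [ik|]; rewrite ?mulr0 //.
    by case/eqP: nk; apply: enum_val_inj; rewrite enum_rankK_in.
  by rewrite -(xconn _ _ (connect_root _ _)) enum_valK.
have := mxrank_ker M; rewrite kerK.
move/eqP: Kfree => -> ->; apply: subnKC; exact: rank_leq_row.
Qed.

Lemma graph_rankE (R : realType) (eps : {set E}) :
  (graph_rank inc eps)%:R =
  #|V|%:R - \sum_u (#|component eps u|%:R)^-1 :> R.
Proof. by rewrite sum_inv_component -(card_roots_rank eps) natrD addrK. Qed.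

End GraphRank.

(** * Finite clusters and their weights *)

Section ClusterGeneral.
Variable G : tiling.
Implicit Types (C : subgraph G) (x y w : vertex G).

(** Connectedness of C seen from x as an induction principle, which transfers along
    maps of tilings more easily than paths do. *)
Definition spans C x := forall P : set (vertex G), P x ->
  (forall y z, P y -> linked C y z -> P z) -> forall w, w \in C.1 -> P w.

Lemma clustersE C x : clusters x C <->
  [/\ x \in C.1, forall e u, e \in C.2 -> on u e -> u \in C.1 &
      forall u, u \in C.1 -> spans C u].
Proof.
split=> -[xC closed conn]; split=> // u.
  move=> uC P Pu Pcl w wC; have [s + sw] := conn u w uC wC.
  elim: s u Pu sw {uC} => [|z s IH] u Pu /= sw; first by rewrite -sw.
  by move=> /andP[uz]; apply: IH => //; apply: Pcl uz.
move=> w uC; apply: (conn u uC (fun w => exists2 s, path (linked C) u s & last u s = w)).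
  by exists [::].
move=> y z [s ps sy] yz; exists (rcons s z); last by rewrite last_rcons.
by rewrite rcons_path ps sy.
Qed.

(** The probability, at density q, that the open cluster of a vertex of C is C. *)
Definition cluster_weight (R : realType) (q : R) C : R :=
  q ^+ #|` C.2| * (1 - q) ^+ card_boundary C.

Lemma cluster_weight_ge0 (R : realType) (q : R) C :
  0 <= q <= 1 -> 0 <= cluster_weight q C.
Proof.
by move=> /andP[q0 q1]; rewrite mulr_ge0 // exprn_ge0 // subr_ge0.
Qed.

End ClusterGeneral.

Section FiniteClusters.
Variable T : finTiling.
Implicit Types (eps : {set fedge T}) (u : fvertex T).

Notation component eps u := (component (@fon T) eps u).

Definition cluster_of eps u : subgraph T :=
  ([fset w in component eps u]%fset,
   [fset e in eps | [exists w in component eps u, fon w e]]%fset).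

Definition compatible (C : subgraph T) eps : bool :=
  ([set e | e \in C.2]%SET \subset eps) &&
  [disjoint [set e | `[< boundary C e >]]%SET & eps].

Lemma cluster_of_card eps u : #|` (cluster_of eps u).1| = #|component eps u|.
Proof. by rewrite card_finset. Qed.

Lemma linked_cluster_of eps u x y : x \in component eps u ->
  open_adj (@fon T) eps x y -> linked (cluster_of eps u) x y.
Proof.
move=> xu /existsP[e /and3P[ee xe ye]]; apply/hasP; exists e; rewrite /= ?xe ?ye //.
rewrite !inE /= ee /=; apply/existsP; exists x; by rewrite xu.
Qed.

Lemma cluster_of_clusters eps u : @clusters T u (cluster_of eps u).
Proof.
apply/clustersE; split=> [|e w|].
- by rewrite !inE connect0.
- rewrite !inE /= => /andP[ee /existsP[x /andP[xu xe]]] we.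
  move: xu; rewrite !inE => /connect_trans; apply; apply: connect1.
  by apply/existsP; exists e; rewrite ee xe.
move=> x; rewrite !inE => ux P Px Pcl w; rewrite !inE => uw.
have : connect (open_adj (@fon T) eps) x w.
  by apply: connect_trans uw; rewrite (open_adj_sym (@fon T) eps).
move=> /connectP[s]; elim: s x ux Px => [|z s IH] x ux Px /=.
  by move=> _ ->.
move=> /andP[xz zs] ws; apply: (IH z) => //.
  by apply: connect_trans ux _; apply: connect1.
by apply: Pcl Px _; apply: linked_cluster_of => //; rewrite inE.
Qed.

(** If the edges of C are open and its boundary edges closed, open paths from u
    reach all of C.1 and cannot leave it.  Every edge must have an end, because
    an edge without ends is never part of [cluster_of eps u]. *)
Lemma cluster_ofP (C : subgraph T) eps u :
  (forall e, exists w, @fon T w e) ->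
  @clusters T u C -> (cluster_of eps u == C) = compatible C eps.
Proof.
move=> has_end /clustersE[uC Cclosed Cspan]; apply/eqP/andP.
  move=> <-; split.
    by apply/fintype.subsetP => e; rewrite !inE => /andP[].
  apply/pred0P => e /=; rewrite !inE; apply/negP => /andP[/asboolP[[w wu we]] + ee].
  rewrite !inE /= ee /=; apply/negP; rewrite negbK.
  by apply/existsP; exists w; move: wu; rewrite !inE => ->.
move=> [/fintype.subsetP Ceps /pred0P dC].
(* An open edge at a vertex of C is not in the boundary, so it is in C. *)
have inC x e : x \in C.1 -> fon x e -> e \in eps -> e \in C.2.
  move=> xC xe ee; apply/negPn/negP => eC; have := dC e; rewrite /= inE ee andbT.
  by move/asboolP; apply; split=> //; exists x.
have C1 x : (x \in component eps u) = (x \in C.1).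
  apply/idP/idP; rewrite inE.
    move=> /connectP[s + ->]; elim: s u uC {x} => [|z s IH] x xC //=.
    move=> /andP[/existsP[e /and3P[ee xe ze]]]; apply: IH.
    by apply: (Cclosed e) => //; apply: inC xe ee.
  apply: (Cspan u uC (fun x => connect (open_adj (@fon T) eps) u x)) => //.
  move=> y z /connect_trans + /hasP[e eC /andP[ye ze]]; apply; apply: connect1.
  by apply/existsP; exists e; apply/and3P; split=> //; apply: Ceps; rewrite inE.
case: C {Cspan} Cclosed inC C1 uC Ceps dC => V E /= Cclosed inC C1 _ Ceps _.
congr pair; apply/fsetP => x; rewrite !inE /=.
  by have := C1 x; rewrite inE.
apply/andP/idP => [[xe /existsP[w /andP[wu we]]]|xE].
  by apply: inC we xe; rewrite -C1.
have [w we] := has_end x.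
split; first by apply: Ceps; rewrite inE.
by apply/existsP; exists w; rewrite we andbT C1 (Cclosed x).
Qed.

End FiniteClusters.

Lemma card_set_of_fset (I : finType) (A : {fset I}) :
  #|[set e | e \in A]%SET| = #|` A|.
Proof.
rewrite cardsE -card_finset; congr (size (enum_fset _)).
by apply/fsetP => e; rewrite !inE.
Qed.

Section ClusterExpectation.
Variables (R : realType) (T : finTiling).
Hypothesis has_end : forall e, exists w, @fon T w e.

Notation component eps u := (component (@fon T) eps u).

Lemma card_compatible (C : subgraph T) :
  #|[set e | e \in C.2]%SET| = #|` C.2| /\
  #|[set e | `[< boundary C e >]]%SET| = card_boundary C.
Proof.
split; first exact: card_set_of_fset.
rewrite /card_boundary -[RHS](@card_set_of_fset (fedge T)); apply: eq_card => e.
rewrite !inE in_fset_set; last exact: (@finite_finset (fedge T)).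
by apply/asboolP/idP => [?|/set_mem//]; exact/mem_set.
Qed.

Lemma prob_cluster_of (q : R) u (C : subgraph T) : @clusters T u C ->
  \sum_(eps | cluster_of eps u == C)
     q ^+ #|eps| * (1 - q) ^+ #|(~: eps)%SET| = cluster_weight q C.
Proof.
move=> uC; under eq_bigl => eps do rewrite cluster_ofP //.
have [c1 c2] := card_compatible C.
rewrite bernoulli_cylinder ?c1 ?c2 //; apply/pred0P => e /=.
rewrite !inE; apply/negP => /andP[eC /asboolP[_]]; by rewrite eC.
Qed.

(** Group the configurations by the cluster of u they produce. *)
Lemma expectation_component (q : R) (h : nat -> R) u :
  0 <= q <= 1 -> (forall n, 0 <= h n) ->
  (bernoulli_expectation q (fun eps => h #|component eps u|))%:E =
  (\esum_(C in @clusters T u) (cluster_weight q C * h #|` C.1|)%:E)%E.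
Proof.
move=> q01 h0.
(* The subgraphs of a finite tiling form a finite type, so that the sum over
   clusters is a finite sum, extended by 0 to all subgraphs. *)
rewrite esum_mkcond.
pose J : finType := ({fset fvertex T} * {fset fedge T})%type.
rewrite esum_fset; first last.
- move=> C _; case: ifP => // _; rewrite lee_fin; apply: mulr_ge0 => //.
  exact: cluster_weight_ge0.
- exact: (@finite_finset J setT).
have -> : [set: subgraph T]%classic = [set` index_enum J]%classic.
  by apply/seteqP; split=> // C _ /=; rewrite (@mem_index_enum J).
rewrite -(@fsbig_seq _ _ _ J) ?index_enum_uniq // /bernoulli_expectation.
rewrite (partition_big (fun eps => cluster_of eps u : J) predT) //= -sumEFin.
apply: eq_bigr => C _; case: ifPn => [/set_mem uC|uC].
  rewrite -(prob_cluster_of q uC) mulr_suml; congr (_%:E).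
  by apply: eq_bigr => eps /eqP <-; rewrite cluster_of_card.
rewrite big_pred0 // => eps; apply/negP => /eqP epsC.
by move/negP: uC; apply; apply/mem_set; rewrite -epsC; exact: cluster_of_clusters.
Qed.

End ClusterExpectation.

(** * Small clusters live in balls *)

Section Balls.
Variable G : tiling.
Implicit Types (x y u w : vertex G) (C : subgraph G).

Lemma ball_edge_of_end n u w e : ball_vertex n u w -> on w e -> ball_edge n.+1 u e.
Proof.
move=> uw we x xe; have [<-|wx] := eqVneq w x; first by left.
by right; exists w => //; split=> //; exists e.
Qed.

Lemma ball_vertex_path n u (r : rel (vertex G)) s :
  (forall x y, r x y -> exists e, on x e /\ on y e) ->
  path r u s -> (size s <= n)%N -> ball_vertex n u (last u s).
Proof.
move=> rP; elim/last_ind: s n => [|s x IH] n; last first.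
  rewrite size_rcons last_rcons rcons_path => /andP[ps sx]; case: n => // n sn.
  have [<-|nx] := eqVneq (last u s) x; first by left; apply: IH.
  by right; exists (last u s); [apply: IH | split=> //; exact: rP].
by move=> _ _; elim: n => [//|n IHn]; left.
Qed.

(** A duplicate-free path inside C from u to w has at most |C.1| vertices, hence at
    most n edges. *)
Lemma cluster_ball u C n w : clusters u C -> (#|` C.1| <= n.+1)%N ->
  w \in C.1 -> ball_vertex n u w.
Proof.
move=> [uC Cclosed conn] Cn wC; have [s us <-] := conn u w uC wC.
case/shortenP: us => s' us' s'uniq _; apply: (ball_vertex_path _ (us')).
  by move=> x y /hasP[e _ /andP[]]; exists e.
rewrite -ltnS; apply: leq_trans Cn.
rewrite -[(size s').+1]/(size (u :: s')); apply: uniq_leq_size => // x.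
rewrite inE => /predU1P[->//|].
elim: s' {s'uniq} u us' {uC s} => // y s IH u /= /andP[/hasP[e eC /andP[_ ye]] ys].
by rewrite inE => /predU1P[->|]; [apply: Cclosed ye | apply: IH ys].
Qed.

(** An edge with one end at distance at most n - 1 from u has both ends within
    distance n: this is why the boundary also fits in the ball of radius n. *)
Lemma small_cluster u C n : clusters u C -> (#|` C.1| <= n)%N ->
  [/\ forall w, w \in C.1 -> ball_vertex n u w,
      forall e, e \in C.2 -> ball_edge n u e &
      forall e, boundary C e -> ball_edge n u e].
Proof.
move=> uC; have [uC1 Cclosed _] := uC.
case: n => [|n] Cn; first by move: Cn; rewrite leqn0 cardfs_eq0 => /eqP C0; rewrite C0 in uC1.
have inball := cluster_ball uC Cn.
split=> [w /inball|e eC w we|e [[w wC we] _]]; first by left.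
  by left; apply: inball; apply: Cclosed we.
by apply: ball_edge_of_end we; apply: inball.
Qed.

End Balls.

Lemma fset_preimage (I J : choiceType) (A : set I) (B : set J) (f : I -> J)
    (X : {fset J}) : set_bij A B f -> (forall y, y \in X -> B y) ->
  exists Y : {fset I}, (forall x, x \in Y -> A x) /\ (f @` Y)%fset = X.
Proof.
move=> [_ _ fsurj] XB.
have pre (y : X) : exists x, A x /\ f x = val y.
  by have [x Ax fx] := fsurj _ (XB _ (valP y)); exists x.
have [g gP] := fin_all_exists pre.
exists [fset g y | y in {: X}]%fset; split.
  by move=> x /imfsetP[y _ ->]; have [] := gP y.
apply/fsetP => y; apply/imfsetP/idP => [[x /imfsetP[z _ ->] ->]|yX].
  by have [_ ->] := gP z; apply: valP.
exists (g [` yX]%fset); last by have [_ ->] := gP [` yX]%fset.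
by apply/imfsetP; exists [` yX]%fset.
Qed.

(** * Transfer of clusters along an isomorphism of balls *)

Section BallTransfer.
Variables (T1 T2 : tiling) (t : nat) (u : vertex T1) (v : vertex T2).
Variables (phi : vertex T1 -> vertex T2) (psi : edge T1 -> edge T2).
Variable (chi : face T1 -> face T2).
Hypothesis iso :
  piece_iso (ball_vertex t u) (ball_edge t u) (ball_face t u)
            (ball_vertex t v) (ball_edge t v) (ball_face t v) phi psi chi.
Hypothesis phiu : phi u = v.

Let image (C : subgraph T1) : subgraph T2 := ((phi @` C.1)%fset, (psi @` C.2)%fset).

Let inside (C : subgraph T1) := 
  (forall x, x \in C.1 -> ball_vertex t u x) /\
  (forall e, e \in C.2 -> ball_edge t u e).

Let phi_inj x y : ball_vertex t u x -> ball_vertex t u y -> phi x = phi y -> x = y.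
Proof. by case: iso => -[_ + _] _ _ _ _ ux uy; apply; exact/mem_set. Qed.

Let psi_inj x y : ball_edge t u x -> ball_edge t u y -> psi x = psi y -> x = y.
Proof. by case: iso => _ [_ + _] _ _ _ ux uy; apply; exact/mem_set. Qed.

Let on_iso x e : ball_vertex t u x -> ball_edge t u e -> on (phi x) (psi e) = on x e.
Proof. by case: iso => _ _ _ + _; apply. Qed.

(** All ends of an edge of a ball lie in the ball, so psi creates no new ends. *)
Lemma image_end C y e : inside C -> e \in C.2 -> on y (psi e) ->
  exists2 x, on x e & y = phi x.
Proof.
move=> [_ C2] eC ye; case: iso => -[_ _ surj] [psiB _ _] _ _ _.
have [x ux xy] := surj y (psiB _ (C2 _ eC) _ ye).
exists x; last by rewrite xy.
by rewrite -on_iso ?xy //; apply: C2.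
Qed.

(** Both directions are needed: one sends clusters to clusters, the other makes
    that map surjective. *)
Lemma image_clusters C : inside C -> clusters v (image C) <-> clusters u C.
Proof.
move=> Cin; have [Cv Ce] := Cin.
have ball_u : ball_vertex t u u by elim: (t) => // n IH; left.
have mem1 x : ball_vertex t u x -> (phi x \in (image C).1) = (x \in C.1).
  move=> ux; apply/imfsetP/idP => /= [[z zC]|xC]; last by exists x.
  by move/(phi_inj ux (Cv _ zC)) ->.
split=> /clustersE[uC closed spn]; apply/clustersE; split.
- by rewrite -mem1 // phiu.
- move=> e x eC xe; have ux := Ce e eC x xe.
  rewrite -mem1 //; apply: (closed (psi e)); first by apply/imfsetP; exists e.
  by rewrite on_iso //; apply: Ce.
- move=> x xC P Px Pcl w wC.
  have phix : phi x \in (image C).1 by rewrite mem1 //; apply: Cv.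
  have phiw : phi w \in (image C).1 by rewrite mem1 //; apply: Cv.
  (* Induct along the image, on the property of having a preimage in C
     that satisfies P. *)
  have := spn _ phix (fun y => exists z, [/\ z \in C.1, phi z = y & P z]) _ _ _ phiw.
  case=> [|y z [y' [y'C <- Py']] /hasP[_ /imfsetP[e /= eC ->] /andP[ye ze]]|z].
  + by exists x.
  + have [z' z'e zz'] := image_end Cin eC ze.
    exists z'; rewrite -mem1; last exact: Ce z'e.
    rewrite -zz'; split=> //.
      by apply: closed ze; apply/imfsetP; exists e.
    apply: Pcl Py' _; apply/hasP; exists e => //.
    by rewrite z'e -on_iso ?ye //; [apply: Cv | apply: Ce].
  + by case=> zC /phi_inj zw; rewrite -zw //; apply: Cv.
- by rewrite -phiu mem1.
- move=> _ y /imfsetP[e /= eC ->] ye.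
  have [x xe ->] := image_end Cin eC ye.
  by rewrite mem1; [apply: closed xe | apply: Ce xe].
- move=> _ /imfsetP[x /= xC ->] P Px Pcl _ /imfsetP[w /= wC ->].
  apply: (spn x xC (P \o phi)) => //= y z Py /hasP[e eC /andP[ye ze]].
  apply: Pcl Py _; apply/hasP; exists (psi e); first by apply/imfsetP; exists e.
  by rewrite !on_iso ?ye ?ze //; try exact: Ce; apply: Ce eC _ _.
Qed.

Lemma image_card C : inside C ->
  #|` (image C).1| = #|` C.1| /\ #|` (image C).2| = #|` C.2|.
Proof.
move=> [Cv Ce]; split; apply: card_in_imfset => x y /= xC yC.
  by apply: phi_inj; apply: Cv.
by apply: psi_inj; apply: Ce.
Qed.

(** The boundary of the image is the image of the boundary, as both boundaries lie
    in the balls where psi is a bijection.  Finiteness ensures that [fset_set]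
    is not the default value. *)
Lemma image_card_boundary C : clusters u C -> (#|` C.1| <= t)%N ->
  finite_set (boundary C) -> card_boundary (image C) = card_boundary C.
Proof.
move=> uC Ct bfin; have [Cv Ce Cb] := small_cluster uC Ct.
have Cin : inside C by [].
have vC : clusters v (image C) by exact/image_clusters.
have Ct' : (#|` (image C).1| <= t)%N by have [-> _] := image_card Cin.
have [Cv' Ce' Cb'] := small_cluster vC Ct'.
have mem2 e : ball_edge t u e -> (psi e \in (image C).2) = (e \in C.2).
  move=> ue; apply/imfsetP/idP => /= [[z zC]|eC]; last by exists e.
  by move/(psi_inj ue (Ce _ zC)) ->.
have bE : boundary (image C) = (psi @` boundary C)%classic.
  apply/seteqP; split=> [e' be'|_ [e be <-]].
    have [_ _ psi_surj] : set_bij (ball_edge t u) (ball_edge t v) psi by case: iso.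
    have [e ue ee'] := psi_surj _ (Cb' _ be').
    exists e => //; move: be'; rewrite -ee' => -[[_ /imfsetP[x /= xC ->] xe] ne].
    split; last by rewrite -mem2.
    by exists x => //; rewrite -on_iso //; apply: Cv.
  have ue := Cb _ be; case: be => -[x xC xe] ne.
  split; last by rewrite mem2.
  exists (phi x); first by apply/imfsetP; exists x.
  by rewrite on_iso //; apply: Cv.
rewrite /card_boundary bE fset_set_image //; apply: card_in_imfset => x y /=.
by rewrite !in_fset_set // => /set_mem xb /set_mem yb; apply: psi_inj; apply: Cb.
Qed.

Lemma image_small_clusters :
  set_bij [set C | clusters u C /\ (#|` C.1| <= t)%N]%classic
          [set C | clusters v C /\ (#|` C.1| <= t)%N]%classic image.
Proof.
split.
- move=> C [uC Ct]; have [Cv Ce _] := small_cluster uC Ct.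
  have [c1 _] := @image_card C (conj Cv Ce).
  by split; [exact/image_clusters | rewrite c1].
- move=> C D /set_mem[uC Ct] /set_mem[uD Dt] CD.
  have [Cv Ce _] := small_cluster uC Ct; have [Dv De _] := small_cluster uD Dt.
  case: C D {uC Ct uD Dt} CD Cv Ce Dv De => [C1 C2] [D1 D2] [/= CD1 CD2] Cv Ce Dv De.
  congr pair; apply/fsetP => x; apply/idP/idP => xM.
  + have : phi x \in (phi @` D1)%fset by rewrite -CD1; apply/imfsetP; exists x.
    by case/imfsetP => y /= yD /phi_inj -> //; [apply: Cv | apply: Dv].
  + have : phi x \in (phi @` C1)%fset by rewrite CD1; apply/imfsetP; exists x.
    by case/imfsetP => y /= yD /phi_inj -> //; [apply: Dv | apply: Cv].
  + have : psi x \in (psi @` D2)%fset by rewrite -CD2; apply/imfsetP; exists x.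
    by case/imfsetP => y /= yD /psi_inj -> //; [apply: Ce | apply: De].
  + have : psi x \in (psi @` C2)%fset by rewrite CD2; apply/imfsetP; exists x.
    by case/imfsetP => y /= yD /psi_inj -> //; [apply: De | apply: Ce].
move=> D [vD Dt]; have [Dv De _] := small_cluster vD Dt.
have [bv be _ _ _] := iso.
have [C1 [Cv C1D]] := fset_preimage bv Dv.
have [C2 [Ce C2D]] := fset_preimage be De.
have Cin : inside (C1, C2) by [].
have imD : image (C1, C2) = D by case: (D) C1D C2D => ? ? /= <- <-.
exists (C1, C2) => //; split; first by apply/image_clusters => //; rewrite imD.
by have [<- _] := image_card Cin; rewrite imD.
Qed.

End BallTransfer.

(** * Duality and counting in finite tilings *)

(** The first incidence matrix is a submatrix of the second, with rows and columns
    chosen by phi and psi, possibly with repetitions. *)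
Lemma graph_rank_le (V E V' E' : finType) (inc : V -> E -> bool)
    (inc' : V' -> E' -> bool) (phi : V -> V') (psi : E -> E')
    (eps : {set E}) (eps' : {set E'}) :
  (forall v e, inc' (phi v) (psi e) = inc v e) ->
  (forall e, e \in eps -> psi e \in eps') ->
  (graph_rank inc eps <= graph_rank inc' eps')%N.
Proof.
move=> incE epsE; rewrite /graph_rank; set M := (X in (\rank X <= _)%N).
set M' := (X in (_ <= \rank X)%N).
pose f (i : 'I_#|V|) := enum_rank (phi (enum_val i)).
pose g (j : 'I_#|eps|) := enum_rank_in (epsE _ (enum_valP j)) (psi (enum_val j)).
have -> : M = mxsub f g M'.
  by apply/matrixP => i j; rewrite !mxE enum_rankK enum_rankK_in ?epsE ?enum_valP ?incE.
rewrite mxsubrc; apply: leq_trans (mxrankS (rowsub_sub _ _)) _.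
by rewrite -mxrank_tr trmx_mxsub -[leqRHS]mxrank_tr; apply: mxrankS; apply: rowsub_sub.
Qed.

Section FiniteTilings.
Variable T : finTiling.

Lemma card_of_II (I : finType) (P : pred I) n :
  ([set x | P x] #= `I_n)%classic%card -> #|P| = n.
Proof.
move=> /(@card_fset_set I) <-; rewrite -cardsE -card_set_of_fset.
apply: eq_card => x; rewrite !inE in_fset_set; last exact: finite_finset.
by apply/idP/idP => [?|/set_mem//]; apply/mem_set.
Qed.

Lemma simple_graph_ends : simple_graph T -> forall e, exists x y,
  x != y /\ forall w, @fon T w e = (w == x) || (w == y).
Proof.
move=> [ends _] e.
have /cards2P[x [y [xy He]]] : #|[set w | @fon T w e]%SET| == 2%N.
  by rewrite cardsE; apply/eqP; apply: card_of_II; exact: ends.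
exists x, y; split=> // w.
by have /setP/(_ w) := He; rewrite !inE.
Qed.

(** Double counting of the incidences between vertices and edges. *)
Lemma handshake m : regular_tiling m T ->
  (m * #|fvertex T| = 2 * #|fedge T|)%N.
Proof.
move=> [[ends _] _ deg _].
have -> : (m * #|fvertex T| = \sum_(v : fvertex T) \sum_(e | fon v e) 1)%N.
  rewrite mulnC -sum_nat_const; apply: eq_bigr => v _.
  by rewrite sum1_card; apply/esym/card_of_II; exact: deg.
rewrite (exchange_big_dep xpredT) //= mulnC -sum_nat_const; apply: eq_bigr => e _.
by rewrite sum1_card; apply: card_of_II; exact: ends.
Qed.

Lemma self_dual_rank : self_dual T ->
  exists psi : fedge T -> fedge T, bijective psi /\
  forall eps : {set fedge T}, dual_rank (psi @: eps)%SET = primal_rank eps.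
Proof.
move=> [phi [psi [chi [bphi bpsi _ incE _]]]].
move: (bphi); rewrite setTT_bijective => -[phi' phiK phi'K].
move: (bpsi); rewrite setTT_bijective => -[psi' psiK psi'K].
exists psi; split; first by exists psi'.
have {}incE v e : @fbd T (psi e) (phi v) = @fon T v e by exact: incE.
move=> eps; apply/eqP; rewrite eqn_leq; apply/andP; split.
  apply: (@graph_rank_le _ _ _ _ _ _ phi' psi') => [f e|_ /imsetP[e ee ->]].
    by rewrite -incE phi'K psi'K.
  by rewrite psiK.
by apply: (@graph_rank_le _ _ _ _ _ _ phi psi) => // e ee; apply: imset_f.
Qed.

Section Expectation.
Variable R : realType.
Implicit Types (q : R) (X Y : {set fedge T} -> R).

Lemma bernoulli_le q X Y : 0 <= q <= 1 -> (forall eps, X eps <= Y eps) ->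
  bernoulli_expectation q X <= bernoulli_expectation q Y.
Proof.
move=> /andP[q0 q1] XY; apply: ler_sum => eps _; apply: ler_wpM2l (XY eps).
by rewrite mulr_ge0 // exprn_ge0 // subr_ge0.
Qed.

Lemma bernoulliD q X Y : bernoulli_expectation q (fun eps => X eps + Y eps) =
  bernoulli_expectation q X + bernoulli_expectation q Y.
Proof. by rewrite -big_split; apply: eq_bigr => eps _; rewrite /= mulrDr. Qed.

Lemma bernoulliZ q (c : R) X : bernoulli_expectation q (fun eps => c * X eps) =
  c * bernoulli_expectation q X.
Proof. by rewrite /bernoulli_expectation mulr_sumr; apply: eq_bigr => eps _; rewrite mulrCA. Qed.

Lemma bernoulli_cst q (c : R) :
  bernoulli_expectation q (fun _ : {set fedge T} => c) = c.
Proof. by rewrite /bernoulli_expectation -mulr_suml bernoulli_total mul1r. Qed.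

Lemma bernoulli_sum (I : finType) q (X : I -> {set fedge T} -> R) :
  bernoulli_expectation q (fun eps => \sum_i X i eps) =
  \sum_i bernoulli_expectation q (X i).
Proof. by rewrite exchange_big; apply: eq_bigr => eps _; rewrite mulr_sumr. Qed.

Lemma expectation_primal_rank q : simple_graph T ->
  bernoulli_expectation q (fun eps => (@primal_rank T eps)%:R) =
  #|fvertex T|%:R - \sum_u bernoulli_expectation q
     (fun eps => (#|component (@fon T) eps u|%:R)^-1).
Proof.
move=> simpleT; rewrite -bernoulli_sum -[in RHS](bernoulli_cst q #|fvertex T|%:R).
rewrite -mulN1r -bernoulliZ -bernoulliD; apply: eq_bigr => eps _.
by rewrite mulN1r /primal_rank (graph_rankE (simple_graph_ends simpleT)).
Qed.

(** Substitute the complement of psi eps for eps, where psi is the action of a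
    self-duality on edges: this exchanges the numbers of open and closed edges,
    hence q and 1 - q, and turns the dual rank into the primal rank. *)
Lemma expectation_dual_rank q : self_dual T ->
  bernoulli_expectation q (fun eps => (@dual_rank T (~: eps)%SET)%:R) =
  bernoulli_expectation (1 - q) (fun eps => (@primal_rank T eps)%:R) :> R.
Proof.
move=> /self_dual_rank[psi [psi_bij rankE]].
have psi_inj := bij_inj psi_bij.
have hbij : bijective (fun eps : {set fedge T} => ~: (psi @: eps))%SET.
  apply: injF_bij => eps eps' /finset.setC_inj; exact: imset_inj.
rewrite /bernoulli_expectation (reindex _ (onW_bij _ hbij)) /=.
apply: eq_bigr => eps _; rewrite finset.setCK rankE subKr; congr (_ * _).
rewrite [LHS]mulrC; congr (_ ^+ _ * _ ^+ _); first exact: card_imset.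
by apply/eqP; rewrite -(eqn_add2l #|eps|) cardsC -[in X in (X + _)%N](card_imset _ psi_inj) cardsC.
Qed.

End Expectation.
End FiniteTilings.

(** * Sums over clusters as limits of truncated sums *)

Section Truncation.
Variables (R : realType) (I : choiceType) (D : set I) (height : I -> nat).
Variable (f : I -> \bar R).
Hypothesis f_ge0 : forall i, (0 <= f i)%E.

Let upto n := [set i | D i /\ (height i <= n)%N]%classic.

Lemma esum_subset (A B : set I) : (A `<=` B)%classic ->
  (\esum_(i in A) f i <= \esum_(i in B) f i)%E.
Proof.
move=> AB; rewrite -(classical_sets.setIidr AB) esum_mkcondr.
by apply: le_esum => i _; case: ifP.
Qed.

(** A finite subfamily has bounded height, so it is dominated by some truncated
    sum; truncated sums increase, hence converge to their supremum. *)
Lemma esum_truncation_cvg :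
  ((fun n => (\esum_(i in upto n) f i)%E) @ \oo --> (\esum_(i in D) f i)%E)%classic.
Proof.
have -> : (\esum_(i in D) f i =
    ereal_sup (range (fun n => \esum_(i in upto n) f i)))%E.
  apply/eqP; rewrite eq_le; apply/andP; split; last first.
    by apply: ge_ereal_sup => _ [n _ <-]; apply: esum_subset => i [].
  apply: ge_ereal_sup => _ [X [Xfin XD] <-].
  apply: le_trans (ereal_sup_ubound _); last first.
    by exists (\max_(i <- fset_set X) height i) => //.
  apply: esum_ge; exists X => //; split=> // i Xi; split; first exact: XD.
  by apply: leq_bigmax_seq => //; rewrite in_fset_set //; apply/mem_set.
apply: ereal_nondecreasing_cvgn => n n' nn'; apply: esum_subset => i [Di sn].
by split=> //; apply: leq_trans nn'.
Qed.

End Truncation.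

(** * Local limit of the mean inverse cluster size *)

Section LocalLimit.
Variables (R : realType) (m : nat) (G : tiling) (v : vertex G).

Definition inv_upto (t n : nat) : R := if (n <= t)%N then n%:R^-1 else 0.

(** Contribution of C to the expectation of 1 / |component of v|. *)
Definition cluster_share (q : R) (C : subgraph G) : R :=
  cluster_weight q C / #|` C.1|%:R.

Lemma cluster_share_ge0 q C : 0 <= q <= 1 -> 0 <= cluster_share q C.
Proof. by move=> q01; rewrite divr_ge0 ?cluster_weight_ge0. Qed.

Definition small_sum (q : R) (t : nat) : \bar R :=
  (\esum_(C in [set C | clusters v C /\ (#|` C.1| <= t)%N]%classic)
     (cluster_share q C)%:E)%E.

(** The cut-off expectation depends on the ball of radius t only: it is a sum over
    clusters with at most t vertices, which the ball isomorphism carries to G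
    together with their three cardinalities. *)
Lemma small_sum_expectation (T : finTiling) (t : nat) (u : vertex T) (q : R) :
  simple_graph T -> isomorphic_balls t u v -> 0 <= q <= 1 ->
  small_sum q t =
  (bernoulli_expectation q (fun eps : {set fedge T} => 
     inv_upto t #|component (@fon T) eps u|))%:E.
Proof.
move=> simpleT [phi [psi [chi [iso phiu]]]] q01.
rewrite expectation_component //; first last.
- by move=> n; rewrite /inv_upto; case: ifP => // _; rewrite invr_ge0.
- by move=> e; have [x [y [_ He]]] := simple_graph_ends simpleT e; exists x; rewrite He eqxx.
rewrite /small_sum (@reindex_esum _ _ _ _ _ _ _ (image_small_clusters iso phiu)).
have -> : [set C | @clusters T u C /\ (#|` C.1| <= t)%N]%classic =
  (@clusters T u `&` [set C | (#|` C.1| <= t)%N])%classic by [].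
rewrite esum_mkcondr; apply: eq_esum => C uC; rewrite /inv_upto.
case: ifPn => [/set_mem Ct|/negP Ct]; last first.
  by rewrite ifN ?mulr0 //; apply/negP => Ct'; apply: Ct; apply/mem_set.
rewrite ifT //.
have [Cv Ce _] := small_cluster uC Ct.
have [c1 c2] := image_card iso (conj Cv Ce).
rewrite /cluster_share /cluster_weight c1 c2 (image_card_boundary iso phiu) //.
exact: (@finite_finset (fedge T)).
Qed.

Definition mean_share (T : finTiling) (q : R) : R :=
  #|fvertex T|%:R^-1 * \sum_u bernoulli_expectation q
     (fun eps : {set fedge T} => (#|component (@fon T) eps u|%:R)^-1).

Lemma inv_upto_le t n : inv_upto t n <= n%:R^-1 <= inv_upto t n + @harmonic R t.
Proof.
rewrite /inv_upto /=; case: leqP => tn; rewrite ?lexx ?add0r ?invr_ge0 //=.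
  by rewrite lerDl invr_ge0.
rewrite ler0n lef_pV2 ?ler_nat ?posrE ?ltr0n //; exact: leq_ltn_trans tn.
Qed.

Lemma inv_upto_le1 t n : inv_upto t n <= 1.
Proof.
rewrite /inv_upto; case: ifP => // _; case: n => [|n]; first by rewrite invr0.
by rewrite invf_le1 // ler1n.
Qed.

(** Components with more than t vertices add at most 1 / (t + 1) to the expectation
    of the cut-off inverse size, which is the same small sum at all u. *)
Lemma mean_share_bounds (T : finTiling) (t : nat) (q : R) :
  simple_graph T -> (0 < #|fvertex T|)%N ->
  (forall u : vertex T, isomorphic_balls t u v) -> 0 <= q <= 1 ->
  [/\ (small_sum q t <= 1)%E, fine (small_sum q t) <= mean_share T q &
      mean_share T q <= fine (small_sum q t) + @harmonic R t].
Proof.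
move=> simpleT V0 balls q01.
have sE u := small_sum_expectation simpleT (balls u) q01.
have VV : #|fvertex T|%:R != 0 :> R by rewrite pnatr_eq0 -lt0n.
have meanE (c : R) : c = #|fvertex T|%:R^-1 * \sum_(u : fvertex T) c.
  by rewrite sumr_const -[c *+ _]mulr_natl mulKf.
have V0' : 0 <= #|fvertex T|%:R^-1 :> R by rewrite invr_ge0.
split.
- have /card_gt0P[u _] := V0; rewrite (sE u) lee_fin.
  rewrite -[leRHS](bernoulli_cst T q); apply: bernoulli_le => // eps.
  exact: inv_upto_le1.
- rewrite [leLHS]meanE; apply: ler_wpM2l => //; apply: ler_sum => u _.
  rewrite (sE u); apply: bernoulli_le => // eps.
  by have /andP[] := inv_upto_le t #|component (@fon T) eps u|.
rewrite [leRHS]meanE; apply: ler_wpM2l => //; apply: ler_sum => u _.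
rewrite (sE u) -(bernoulli_cst T q (harmonic t)) -bernoulliD.
apply: bernoulli_le => // eps.
by have /andP[] := inv_upto_le t #|component (@fon T) eps u|.
Qed.

Lemma mean_share_cvg (T : nat -> finTiling) (q : R) :
  (forall t, (m <= t)%N -> simple_graph (T t)) ->
  (forall t, (m <= t)%N -> (0 < #|fvertex (T t)|)%N) ->
  (forall t, (m <= t)%N -> forall u : vertex (T t), isomorphic_balls t u v) ->
  0 <= q <= 1 ->
  exists2 l : R, (\esum_(C in clusters v) (cluster_share q C)%:E)%E = l%:E &
    ((fun t => mean_share (T t) q) @ \oo --> l)%classic.
Proof.
move=> simpleT V0 balls q01.
have bounds t (mt : (m <= t)%N) := mean_share_bounds (simpleT t mt) (V0 t mt) (balls t mt) q01.
have cvgS : (small_sum q @ \oo --> (\esum_(C in clusters v) (cluster_share q C)%:E)%E)%classic.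
  by apply: esum_truncation_cvg => C; rewrite lee_fin cluster_share_ge0.
have S1 : (\esum_(C in clusters v) (cluster_share q C)%:E <= 1)%E.
  apply: (@cvge_le _ _ _ _ _ _ _ _ cvgS).
  by exists m => // t /= mt; have [] := bounds t mt.
have Sfin : (\esum_(C in clusters v) (cluster_share q C)%:E)%E \is a fin_num.
  rewrite ge0_fin_numE; first by apply: le_lt_trans S1 (ltry _).
  by apply: esum_ge0 => C _; rewrite lee_fin cluster_share_ge0.
exists (fine (\esum_(C in clusters v) (cluster_share q C)%:E)%E); first by rewrite fineK.
rewrite -{1}(fineK Sfin) in cvgS.
have {}cvgS : (fine \o small_sum q @ \oo -->
    fine (\esum_(C in clusters v) (cluster_share q C)%:E)%E)%classic.
  exact: fine_cvg cvgS.
apply: (squeeze_cvgr (h := fun t => fine (small_sum q t) + @harmonic R t) _ cvgS).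
  by exists m => // t /= mt; have [_ -> ->] := bounds t mt.
rewrite -[fine (esum _ _)]addr0; apply: cvgD => //; exact: cvg_harmonic.
Qed.

End LocalLimit.

(** * The rank difference *)

(** The vertex counts cancel between primal and dual, and m |V| = 2 |E| converts
    the normalisation by edges into one by vertices. *)
Lemma mean_rank_difference (R : realType) (m : nat) (T : finTiling) (q : R) :
  regular_tiling m T -> self_dual T -> (0 < m)%N -> (0 < #|fvertex T|)%N ->
  bernoulli_expectation q (fun eps : {set fedge T} =>
    ((dual_rank (~: eps)%SET)%:R - (primal_rank eps)%:R) / #|fedge T|%:R) =
  2 / m%:R * (mean_share T q - mean_share T (1 - q)).
Proof.
move=> regT sdT m0 V0.
have simpleT : simple_graph T by case: regT.
have VV : #|fvertex T|%:R != 0 :> R by rewrite pnatr_eq0 -lt0n.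
have mm : m%:R != 0 :> R by rewrite pnatr_eq0 -lt0n.
have hs : m%:R * #|fvertex T|%:R = 2 * #|fedge T|%:R :> R.
  by rewrite -!natrM (handshake regT).
have EE : #|fedge T|%:R != 0 :> R.
  have : m%:R * #|fvertex T|%:R != 0 :> R by rewrite mulf_neq0.
  by rewrite hs mulf_eq0 negb_or => /andP[].
transitivity (#|fedge T|%:R^-1 *
   (bernoulli_expectation q (fun eps => (@dual_rank T (~: eps)%SET)%:R)
    + -1 * bernoulli_expectation q (fun eps => (@primal_rank T eps)%:R))).
  rewrite -bernoulliZ -bernoulliD -bernoulliZ; apply: eq_bigr => eps _.
  by rewrite mulN1r [X in _ * X = _]mulrC.
rewrite mulN1r expectation_dual_rank // !expectation_primal_rank // /mean_share -mulrBr.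
set A := (X in _ - X - _); set B := (X in _ - (_ - X)).
have -> : (2 / m%:R : R) = #|fvertex T|%:R / #|fedge T|%:R.
  by apply/eqP; rewrite eqr_div // -hs mulrC.
by rewrite mulrACA divff // mul1r opprB addrC addrA subrK.
Qed.

Theorem theorem5p3 (R : realType) (m : nat) (hm : (5 <= m)%N)
    (p : R) (hp0 : 0 < p) (hp : p <= 1 / 2)
    (G : tiling) (hG : regular_plane_tiling R m G) (v : vertex G)
    (gT : nat -> finGroupType) (a b : forall t : nat, gT t)
    (hfam : tiling_family m G a b) :
  let term := fun C : subgraph G =>
    (#|` C.1|%:R)^-1 *
      (p ^+ #|` C.2| * (1 - p) ^+ card_boundary C
       - (1 - p) ^+ #|` C.2| * p ^+ card_boundary C) in
  summable (clusters v) (fun C => (term C)%:E) /\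
  rank_difference (fun t => coset_tiling (a t) (b t)) p
    = ((2 / m%:R)%:E * signed_esum (clusters v) term)%E.
Proof.
move=> term.
pose T t := coset_tiling (a t) (b t).
have reg t (mt : (m <= t)%N) : regular_tiling m (T t) := family_regular hfam mt.
have simpleT t (mt : (m <= t)%N) : simple_graph (T t) by case: (reg t mt).
have V0 t (mt : (m <= t)%N) : (0 < #|fvertex (T t)|)%N.
  (* The subgroup generated by a is itself a left coset, hence a vertex. *)
  have g1 : <[a t]>%g \in lcosets <[a t]>%g [set: gT t]%SET.
    by apply/imsetP; exists 1%g; rewrite ?inE // lcosetE mul1g.
  by apply/card_gt0P; exists (exist (fun A => A \in lcosets <[a t]>%g [set: gT t]%SET) _ g1).
have balls t (mt : (m <= t)%N) (u : vertex (T t)) : isomorphic_balls t u v.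
  exact: (family_balls hfam mt).
have p01 : 0 <= p <= 1.
  by rewrite ltW //= (le_trans hp) // ler_pdivrMr // mul1r ler1n.
have q01 : 0 <= 1 - p <= 1.
  by case/andP: p01 => p0 p1; rewrite subr_ge0 p1 gerBl.
have [l lE lcvg] := mean_share_cvg simpleT V0 balls p01.
have [l' lE' lcvg'] := mean_share_cvg simpleT V0 balls q01.
have termE C : (term C)%:E =
    ((EFin \o cluster_share p) \- (EFin \o cluster_share (1 - p)))%E C.
  by rewrite /= -EFinB /term /cluster_share /cluster_weight subKr -mulrBl mulrC.
have share_summable (q x : R) : 0 <= q <= 1 ->
    (\esum_(C in clusters v) (cluster_share q C)%:E)%E = x%:E ->
    summable (clusters v) (EFin \o cluster_share q).
  move=> qq xE; rewrite /summable (eq_esum (b := EFin \o cluster_share q)) => [|C _].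
    by rewrite xE ltry.
  by rewrite gee0_abs // lee_fin cluster_share_ge0.
have sp := share_summable p l p01 lE.
have sq := share_summable (1 - p) l' q01 lE'.
have -> : (fun C => (term C)%:E) =
    ((EFin \o cluster_share p) \- (EFin \o cluster_share (1 - p)))%E.
  by apply/funext => C; rewrite termE.
split; first exact: summableB.
have -> : signed_esum (clusters v) term = (l - l')%:E.
  rewrite /signed_esum (_ : EFin \o term =
    ((EFin \o cluster_share p) \- (EFin \o cluster_share (1 - p)))%E); last first.
    by apply/funext => C; rewrite /= termE.
  rewrite esumB // => [|C _|C _]; last 2 first.
  - by rewrite lee_fin cluster_share_ge0.
  - by rewrite lee_fin cluster_share_ge0.
  by rewrite EFinB -lE -lE'.
rewrite -EFinM /rank_difference; set u := (X in limn_esup X).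
have ucvg : (u @ \oo --> (2 / m%:R * (l - l'))%:E)%classic.
  have : ((fun t => (2 / m%:R * (mean_share (T t) p - mean_share (T t) (1 - p)))%:E)
     @ \oo --> (2 / m%:R * (l - l'))%:E)%classic.
    apply: cvg_EFin; first by apply: nearW.
    by apply: cvgM; [exact: cvg_cst | apply: cvgB].
  (* The tilings are only controlled from index m on. *)
  apply: cvg_trans; apply: near_eq_cvg; exists m => // t /= mt.
  rewrite /u -(mean_rank_difference _ (reg t mt) (family_self_dual hfam mt)) ?V0 //.
  exact: leq_trans hm.
by rewrite is_cvg_limn_esupE; [apply: cvg_lim | apply/cvg_ex; eexists; exact: ucvg].
Qed.
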